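(* Let $n=pq$ be an RSA modulus such that either $2^{p-1}\not\equiv 1 \pmod q$ or $2^{q-1}\not\equiv 1\pmod p$. Then the number $d$ given by the following algorithm (which uses the oracle $\mathcal O$ described in the context), in polynomial time in $\log n$, is a prime divisor of $n$: (1) Send $n'=2^n+1$ in binary form to $\mathcal O$, which answers with a set $S$. (2) Take $r\in S$, $r\ne 1,3$, and compute $d=\gcd(r-1,n)$.
   Context: An RSA modulus is a product $n=pq$ of two primes, labelled so that $p<q$. Oracle $\mathcal O$: it is assumed that there is an oracle which, on input $n'=2^n+1$, returns the residue classes modulo $n$ of three prime factors $r\mid n'$. All that is needed is the residue class modulo $n$ of one factor of $n'$ different from $1$ and $3$, so one may equally admit an oracle answering with any set $S\subset\{r \bmod n : r \text{ prime},\ r\mid n'\}$ of polynomial size with $S\not\subseteq\{1,3\}$. The conditions $r\neq 1,3$ and $S\not\subseteq\{1,3\}$ refer to residue classes modulo $n$. The binary form of $n'$ is a $1$, followed by $n-1$ zeros, followed by a $1$, so an efficient encoding of $n'$ of size comparable to $n$ is available. *)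

(* Defs.v *)
From mathcomp Require Import all_boot all_order all_algebra.

Set Implicit Arguments.
Unset Strict Implicit.
Unset Printing Implicit Defensive.

Definition rsa_modulus (n p q : nat) : Prop :=
  [/\ prime p, prime q, p < q & n = p * q].

(* A residue class modulo n is given by its representative in [0, n).  The
   sequence S lists the elements of a finite set of classes, in any order and
   possibly with repetitions. *)
Definition valid_answer (n : nat) (S : seq nat) : Prop :=
  (forall s, s \in S -> exists2 r, prime r && (r %| 2 ^ n + 1) & s = r %% n)
  /\ ~ {subset S <= [:: 1 %% n; 3 %% n]}.

Definition eligible (n : nat) (S : seq nat) (r : nat) : Prop :=
  [/\ r \in S, r != 1 %[mod n] & r != 3 %[mod n]].

(* Running time is measured on an oracle register machine, presented as a
   while-language, under the logarithmic cost criterion: an operation is charged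
   the number of bits it handles, and a division the product of the lengths of
   its operands (schoolbook long division). *)

Definition bits (k : nat) : nat := (trunc_log 2 k).+1.

Inductive aexp : Type :=
  | Cst of nat
  | Var of nat
  | Sub of aexp & aexp
  | Mod of aexp & aexp.

Inductive bexp : Type :=
  | Eq of aexp & aexp
  | Not of bexp
  | Or of bexp & bexp.

(* [Ask w] sends the oracle the number whose binary form, most significant bit
   first, has the run-length encoding w; only that encoding is paid for.
   [Recv x] stores the next unread element of the answer in register x. *)
Inductive cmd : Type :=
  | Assign of nat & aexp
  | Seq of cmd & cmd
  | While of bexp & cmd
  | Ask of seq (bool * aexp)
  | Recv of nat.

Record state : Type := State { reg : nat -> nat; answer : seq nat }.

Definition set_reg (s : state) (x v : nat) : state :=
  State (fun y => if y == x then v else reg s y) (answer s).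

Fixpoint aval (s : state) (e : aexp) : nat :=
  match e with
  | Cst k => k
  | Var x => reg s x
  | Sub a b => aval s a - aval s b
  | Mod a b => aval s a %% aval s b
  end.

Fixpoint acost (s : state) (e : aexp) : nat :=
  match e with
  | Cst k => bits k
  | Var x => bits (reg s x)
  | Sub a b => acost s a + acost s b + (bits (aval s a) + bits (aval s b))
  | Mod a b => acost s a + acost s b + bits (aval s a) * bits (aval s b)
  end.

Fixpoint bval (s : state) (b : bexp) : bool :=
  match b with
  | Eq a a' => aval s a == aval s a'
  | Not b' => ~~ bval s b'
  | Or b1 b2 => bval s b1 || bval s b2
  end.

Fixpoint bcost (s : state) (b : bexp) : nat :=
  match b with
  | Eq a a' => acost s a + acost s a' + (bits (aval s a) + bits (aval s a'))
  | Not b' => (bcost s b').+1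
  | Or b1 b2 => (bcost s b1 + bcost s b2).+1
  end.

Definition nat_of_bits (w : seq bool) : nat :=
  foldl (fun m (b : bool) => m.*2 + b) 0 w.

Definition query (s : state) (w : seq (bool * aexp)) : nat :=
  nat_of_bits (flatten [seq nseq (aval s u.2) u.1 | u <- w]).

Definition query_cost (s : state) (w : seq (bool * aexp)) : nat :=
  \sum_(u <- w) (1 + acost s u.2 + bits (aval s u.2)).

(* [exec O c s s' t]: with oracle O, command c started in state s halts in state
   s' after time t. *)
Inductive exec (O : nat -> seq nat) : cmd -> state -> state -> nat -> Prop :=
  | ExecAssign x e s :
      exec O (Assign x e) s (set_reg s x (aval s e))
        (acost s e + bits (aval s e))
  | ExecSeq c1 c2 s s1 s2 t1 t2 :
      exec O c1 s s1 t1 -> exec O c2 s1 s2 t2 ->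
      exec O (Seq c1 c2) s s2 (t1 + t2)
  | ExecWhileFalse b c s :
      ~~ bval s b -> exec O (While b c) s s (bcost s b)
  | ExecWhileTrue b c s s1 s2 t1 t2 :
      bval s b -> exec O c s s1 t1 -> exec O (While b c) s1 s2 t2 ->
      exec O (While b c) s s2 (bcost s b + t1 + t2)
  | ExecAsk w s :
      exec O (Ask w) s (State (reg s) (O (query s w))) (query_cost s w)
  | ExecRecv x s :
      exec O (Recv x) s
        (State (reg (set_reg s x (head 0 (answer s)))) (behead (answer s)))
        (bits (head 0 (answer s))).

(* reg_n holds the input and reg_d the output. *)
Definition reg_n : nat := 0.
Definition reg_r : nat := 1.
Definition reg_d : nat := 2.
Definition reg_m : nat := 3.
Definition reg_t : nat := 4.

Definition init (n : nat) : state :=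
  State (fun x => if x == reg_n then n else 0) [::].

Definition send_query : cmd :=
  Ask [:: (true, Cst 1); (false, Sub (Var reg_n) (Cst 1)); (true, Cst 1)].

Definition take_r : cmd :=
  Seq (Recv reg_r)
    (While (Or (Eq (Var reg_r) (Cst 1)) (Eq (Var reg_r) (Cst 3)))
       (Recv reg_r)).

(* Euclid's algorithm on r - 1 and n. *)
Definition compute_d : cmd :=
  Seq (Assign reg_d (Sub (Var reg_r) (Cst 1)))
  (Seq (Assign reg_m (Var reg_n))
    (While (Not (Eq (Var reg_m) (Cst 0)))
      (Seq (Assign reg_t (Mod (Var reg_d) (Var reg_m)))
      (Seq (Assign reg_d (Var reg_m))
           (Assign reg_m (Var reg_t)))))).

Definition factor : cmd := Seq send_query (Seq take_r compute_d).

(* Main.v *)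
Require Import Defs.
From mathcomp Require Import all_boot all_order all_algebra.
From mathcomp Require Import cyclic zify.

(** If a prime [r] divides [2 ^ n + 1], then [2] has order dividing both [2 * n]
    and [r - 1] modulo [r].  When [r - 1] is coprime to [n] this order divides
    [2], so that [r = 3]; when [n] divides [r - 1], the class of [r] is [1].
    For every other [r] the number [gcdn (r - 1) n] is a proper nontrivial
    divisor of [n = p * q], hence prime. *)

(** * Prime factors of [2 ^ n + 1] and divisors of [p * q] *)

Lemma expn_gcd_mod1 (r a b x : nat) :
  0 < a -> x ^ a = 1 %[mod r] -> x ^ b = 1 %[mod r] ->
  x ^ gcdn a b = 1 %[mod r].
Proof.
(* Bézout without subtraction: [u * a = v * b + gcdn a b], so no inverse of [x] modulo [r] is
   taken. *)
move=> a_gt0 xa xb; case: (egcdnP b a_gt0) => u v Huv _.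
have x1 c k : x ^ c = 1 %[mod r] -> x ^ (k * c) = 1 %[mod r].
  by move=> xc; rewrite mulnC expnM -modnXm xc modnXm exp1n.
have : x ^ (u * a) = 1 %[mod r] by exact: x1.
by rewrite Huv expnD -modnMml x1 // modnMml mul1n.
Qed.

Lemma prime_dvd_exp2S_coprime (n r : nat) :
  0 < n -> prime r -> r %| 2 ^ n + 1 -> coprime (r - 1) n -> r = 3.
Proof.
move=> n_gt0 r_pr r_dvd co_rn.
have r_odd : ~~ (2 %| r).
  apply/negP => /dvdn_trans/(_ r_dvd).
  by rewrite dvdn2 oddD oddX orbF eqn0Ngt n_gt0.
have two_r : coprime 2 r by rewrite prime_coprime.
have e1 : 2 ^ (r - 1) = 1 %[mod r].
  by have := Euler_exp_totient two_r; rewrite totient_prime // subn1.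
have e2 : 2 ^ (2 * n) = 1 %[mod r].
  apply/eqP; rewrite eqn_mod_dvd ?expn_gt0 //.
  (* [2 ^ (2 * n) - 1 = (2 ^ n - 1) * (2 ^ n + 1)], and [r] divides the second factor. *)
  by rewrite mulnC expnM -[X in _ - X](exp1n 2) subn_sqr dvdn_mull.
have := expn_gcd_mod1 _ _ _ _ _ e2 e1; rewrite muln_gt0 n_gt0 => /(_ isT).
have -> : gcdn (2 * n) (r - 1) = 2.
  rewrite gcdnC Gauss_gcdl //.
  by apply/gcdn_idPr; have := prime_gt1 r_pr; move: r_odd; lia.
(* Now [r] divides [2 ^ 2 - 1]; being odd and greater than [1], it is [3]. *)
move/eqP; rewrite eqn_mod_dvd // => /dvdn_leq r3.
by have := prime_gt1 r_pr; have := r3 isT; move: r_odd; lia.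
Qed.

(** If [d = k * p], then [k] divides [q], and [k = q] is excluded, so [d = p]. If [p] does not
    divide [d], then [d] divides [q], hence [d = q]. *)
Lemma prime_proper_dvd_mul (p q d : nat) :
  prime p -> prime q -> d %| p * q -> d != 1 -> d != p * q -> prime d.
Proof.
move=> p_pr q_pr d_dvd d_n1 d_npq.
have [p_d|p_nd] := boolP (p %| d).
  case/dvdnP: p_d d_dvd d_n1 d_npq => k ->.
  rewrite [p * q]mulnC dvdn_pmul2r ?prime_gt0 //.
  case/primeP: q_pr => _ qP /qP /orP[] /eqP-> //; first by rewrite mul1n.
  by rewrite eqxx.
move: d_dvd; rewrite Gauss_dvdr; last by rewrite coprime_sym prime_coprime.
case/primeP: (q_pr) => _ qP /qP; rewrite (negPf d_n1) /=.
by move/eqP->.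
Qed.

Lemma mod_factor_gcd_prime (p q s : nat) (n := p * q) :
  prime p -> prime q ->
  (exists2 r, prime r && (r %| 2 ^ n + 1) & s = r %% n) ->
  s != 1 %[mod n] -> s != 3 %[mod n] -> prime (gcdn (s - 1) n).
Proof.
move=> p_pr q_pr [r /andP[r_pr r_dvd] ->]; rewrite !modn_mod => r_n1 r_n3.
have p_gt1 := prime_gt1 p_pr; have q_gt1 := prime_gt1 q_pr.
have n_gt0 : 0 < n by rewrite muln_gt0 !prime_gt0.
(* A zero residue would spoil the truncated [s - 1]. It would mean that [n] divides the prime [r],
   and then its proper divisor [p > 1] would divide [r] too. *)
have r_ge1 : 1 <= r %% n.
  rewrite lt0n; apply/negP => n_r.
  case/primeP: r_pr => _ rP.
  have p_r : p %| r by rewrite (dvdn_trans _ n_r) // dvdn_mulr.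
  have n_gtp : p < n by rewrite -[X in X < _]muln1 ltn_pmul2l ?prime_gt0.
  case/orP: (rP _ n_r) => /eqP n_r'; first by rewrite n_r' ltnNge ltnW in n_gtp.
  by case/orP: (rP _ p_r) => /eqP p_r'; [rewrite p_r' in p_gt1
                                       | rewrite p_r' n_r' ltnn in n_gtp].
have gcdE : gcdn (r %% n - 1) n = gcdn (r - 1) n.
  rewrite {2}(divn_eq r n) -addnBA // gcdnC [RHS]gcdnC.
  by rewrite -gcdn_modr -[RHS]gcdn_modr modnMDl.
apply: (prime_proper_dvd_mul p q) => //; first exact: dvdn_gcdr.
  rewrite gcdE; apply: contra r_n3 => co_rn.
  by rewrite (prime_dvd_exp2S_coprime n r).
rewrite gcdE; apply: contra r_n1 => /eqP gn.
by rewrite eqn_mod_dvd ?prime_gt0 // -[X in X %| _]gn dvdn_gcdl.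
Qed.

(** * Running time of the program *)

Lemma leq_bits (k l : nat) : k <= l -> bits k <= bits l.
Proof. by move=> kl; rewrite ltnS leq_trunc_log. Qed.

Lemma bits0 : bits 0 = 1. Proof. by []. Qed.
Lemma bits1 : bits 1 = 1. Proof. by []. Qed.
Lemma bits3 : bits 3 = 2. Proof. by []. Qed.

(** Induction on the unread answer, with the register counted as its head. A guard costs at most
    [4 * B + 7] and a read at most [B], whence [12 * B] per element. *)
Lemma take_loop_exec (O : nat -> seq nat) (B : nat) (s : state)
    (good := fun x => ~~ ((x == 1) || (x == 3))) :
  0 < B -> has good (reg s reg_r :: answer s) ->
  all (fun x => bits x <= B) (reg s reg_r :: answer s) ->
  exists s' t,
    [/\ exec O (While (Or (Eq (Var reg_r) (Cst 1)) (Eq (Var reg_r) (Cst 3)))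
                 (Recv reg_r)) s s' t,
        reg s' reg_r \in reg s reg_r :: answer s, good (reg s' reg_r),
        reg s' reg_n = reg s reg_n
      & t <= (size (answer s)).+1 * (12 * B)].
Proof.
move=> B_gt0; case: s => f a /=; elim: a f => [|y a IHa] f.
all: have [f_good _|/negPn f_bad] := boolP (good (f reg_r)).
all: rewrite /=.
- rewrite andbT => fB; do 2!eexists; split; first exact: ExecWhileFalse.
  + by rewrite mem_head.
  + by [].
  + by [].
  by rewrite /= bits1 bits3; lia.
(* A rejected register with nothing left to read contradicts [has good], so the default [0] of
   [head] is never received. *)
- by [].
- case/andP => fB _; do 2!eexists; split; first exact: ExecWhileFalse.
  + by rewrite mem_head.
  + by [].
  + by [].
  by rewrite /= bits1 bits3; nia.
move=> y_has /andP[fB y_all].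
set f1 := reg (set_reg (State f (y :: a)) reg_r y).
have [s' [t [ex s'_in s'_good s'_n t_le]]] := IHa f1 y_has y_all.
do 2!eexists; split.
- by apply: ExecWhileTrue; [exact: f_bad | exact: ExecRecv | exact: ex].
- by rewrite in_cons s'_in orbT.
- by [].
- by rewrite s'_n.
by case/andP: y_all => yB _; rewrite /= bits1 bits3; nia.
Qed.

Definition euclid_body : cmd :=
  Seq (Assign reg_t (Mod (Var reg_d) (Var reg_m)))
  (Seq (Assign reg_d (Var reg_m)) (Assign reg_m (Var reg_t))).

(** The guard and the three assignments cost at most [B ^ 2 + 9 * B + 3], and [1 <= B <= B ^ 2]. *)
Lemma euclid_body_exec (O : nat -> seq nat) (B : nat) (s : state) :
  bits (reg s reg_d) <= B -> bits (reg s reg_m) <= B ->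
  exists s' t,
    [/\ exec O euclid_body s s' t, reg s' reg_d = reg s reg_m,
        reg s' reg_m = reg s reg_d %% reg s reg_m
      & bcost s (Not (Eq (Var reg_m) (Cst 0))) + t <= 13 * B ^ 2].
Proof.
move=> dB mB; do 2!eexists; split.
- by do 2!(apply: ExecSeq; first exact: ExecAssign); exact: ExecAssign.
- by [].
- by [].
have tB : bits (reg s reg_d %% reg s reg_m) <= B.
  by apply: leq_trans dB; apply/leq_bits/leq_mod.
have B_gt0 : 0 < B by exact: leq_trans dB.
have BB : B <= B ^ 2 by rewrite -mulnn leq_pmull.
by have := leq_mul dB mB; rewrite /= bits0 mulnn; lia.
Qed.

(* Two turns of the loop replace [m] by [m %% (d %% m)], which is less than
   [m / 2]. *)
Lemma euclid_exec (O : nat -> seq nat) (B k : nat) (s : state) :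
  bits (reg s reg_d) <= B -> bits (reg s reg_m) <= B -> reg s reg_m < 2 ^ k ->
  exists s' t,
    [/\ exec O (While (Not (Eq (Var reg_m) (Cst 0))) euclid_body) s s' t,
        reg s' reg_d = gcdn (reg s reg_d) (reg s reg_m)
      & t <= (2 * k + 1) * (13 * B ^ 2)].
Proof.
(* [X] bounds a full turn as well as the last guard alone: two turns for each unit of [k], plus the
   exit. *)
set X := 13 * B ^ 2.
have cond_cost s' : bits (reg s' reg_m) <= B ->
    bcost s' (Not (Eq (Var reg_m) (Cst 0))) <= X.
  by rewrite /X /= bits0; set b := bits _; have : 0 < b by []; nia.
elim: k s => [|k IHk] s dB mB m_lt.
all: have [m0|m_n0] := eqVneq (reg s reg_m) 0.
- do 2!eexists; split; first by apply: ExecWhileFalse; rewrite /= m0.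
    by rewrite m0 gcdn0.
  by rewrite mul1n; exact: cond_cost.
- by move: m_lt m_n0; rewrite expn0; lia.
- do 2!eexists; split; first by apply: ExecWhileFalse; rewrite /= m0.
    by rewrite m0 gcdn0.
  by apply: leq_trans (cond_cost s mB) _; rewrite leq_pmull // addn1.
have [s1 [t1 [ex1 d1 m1 c1]]] := euclid_body_exec O B s dB mB.
have m_gt0 : 0 < reg s reg_m by rewrite lt0n.
have d1B : bits (reg s1 reg_d) <= B by rewrite d1.
have m1B : bits (reg s1 reg_m) <= B.
  by rewrite m1; apply: leq_trans dB; apply/leq_bits/leq_mod.
have g1 : gcdn (reg s1 reg_d) (reg s1 reg_m) = gcdn (reg s reg_d) (reg s reg_m).
  by rewrite d1 m1 gcdn_modr gcdnC.
have [m10|m1_n0] := eqVneq (reg s1 reg_m) 0.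
  do 2!eexists; split.
  - apply: ExecWhileTrue; [exact: m_n0 | exact: ex1 |].
    by apply: ExecWhileFalse; rewrite /= m10.
  - by rewrite -g1 m10 gcdn0.
  apply: leq_trans (leq_add c1 (cond_cost s1 m1B)) _.
  by rewrite addnn -mul2n leq_mul2r; lia.
have [s2 [t2 [ex2 d2 m2 c2]]] := euclid_body_exec O B s1 d1B m1B.
have d2B : bits (reg s2 reg_d) <= B by rewrite d2.
have m2B : bits (reg s2 reg_m) <= B.
  by rewrite m2; apply: leq_trans d1B; apply/leq_bits/leq_mod.
have m2_lt : reg s2 reg_m < 2 ^ k.
  have m1_lt : reg s1 reg_m < reg s reg_m by rewrite m1 ltn_mod.
  have m2_lt1 : reg s2 reg_m < reg s1 reg_m by rewrite m2 ltn_mod lt0n.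
  (* With [m], [m1], [m2] the successive values of [reg_m], [m = c * m1 + m2] where [c >= 1] and
     [m2 < m1]; hence [2 * m2 < m]. *)
  have := divn_eq (reg s1 reg_d) (reg s1 reg_m); rewrite -m2 d1.
  have : 0 < reg s reg_m %/ reg s1 reg_m by rewrite divn_gt0 ?(ltnW m1_lt) ?lt0n.
  by move: m_lt; rewrite expnS; nia.
have [s3 [t3 [ex3 d3 c3]]] := IHk s2 d2B m2B m2_lt.
do 2!eexists; split.
- apply: ExecWhileTrue; [exact: m_n0 | exact: ex1 |].
  by apply: ExecWhileTrue; [exact: m1_n0 | exact: ex2 | exact: ex3].
- by rewrite d3 d2 m2 gcdn_modr gcdnC g1.
by move: c1 c2 c3; lia.
Qed.

Lemma query_init (n : nat) : 0 < n ->
  query (init n) [:: (true, Cst 1); (false, Defs.Sub (Var reg_n) (Cst 1));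
                     (true, Cst 1)] = 2 ^ n + 1.
Proof.
move=> n_gt0; rewrite /query /nat_of_bits /= foldl_cat /=.
(* Reading [k] zeros multiplies the accumulator by [2 ^ k]; here [k = n - 1], and the final digit
   supplies the last doubling. *)
suff -> m k : foldl (fun a (b : bool) => a.*2 + b) m (nseq k false) = m * 2 ^ k.
  by rewrite mul1n -muln2 -expnSr subn1 prednK.
by elim: k m => [|k IHk] m /=; rewrite ?muln1 // IHk expnS addn0 -muln2 mulnA.
Qed.

(** With [B = bits n], Euclid's loop costs at most [(2 * B + 1) * (13 * B ^ 2)], and the query, the
    first read and the two assignments at most [9 * B + 11]; [26 + 13 + 9 + 11 = 59]. *)
Lemma factor_exec (O : nat -> seq nat) (n : nat) (S := O (2 ^ n + 1)) :
  0 < n -> has (fun x => ~~ ((x == 1) || (x == 3))) S ->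
  all (fun x => x <= n) S ->
  exists r s t,
    [/\ r \in S, ~~ ((r == 1) || (r == 3)), exec O factor (init n) s t,
        reg s reg_d = gcdn (r - 1) n
      & t <= size S * (12 * bits n) + 59 * bits n ^ 3].
Proof.
move=> n_gt0; have := query_init n n_gt0.
set w := [:: _; _; _] => qE.
case ES : S => [|x a] // S_has S_all.
have S_bits : all (fun y => bits y <= bits n) (x :: a).
  by apply: sub_all S_all => y; exact: leq_bits.
set B := bits n in S_bits *.
have B_gt0 : 0 < B by [].
pose s0 := State (reg (init n)) (x :: a).
pose s1 := State (reg (set_reg s0 reg_r x)) a.
have [s2 [t2 [ex2 r_in r_good s2_n t2_le]]] :=
  take_loop_exec O B s1 B_gt0 S_has S_bits.
set r := reg s2 reg_r in r_in r_good.
have rB : bits r <= B by exact: (allP S_bits).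
have r1B : bits (r - 1) <= B by apply: leq_trans rB; apply/leq_bits/leq_subr.
pose s3 := set_reg s2 reg_d (r - 1).
pose s4 := set_reg s3 reg_m (reg s3 reg_n).
have s4_n : reg s4 reg_m = n by exact: s2_n.
have m4B : bits (reg s4 reg_m) <= B by rewrite s4_n.
have m4_lt : reg s4 reg_m < 2 ^ B by rewrite s4_n; exact: trunc_log_ltn.
have [s5 [t5 [ex5 d5 t5_le]]] := euclid_exec O B B s4 r1B m4B m4_lt.
exists r; do 2!eexists; split.
- exact: r_in.
- exact: r_good.
- apply: ExecSeq; first exact: ExecAsk.
  rewrite -/w qE -/S ES; apply: ExecSeq.
    by apply: ExecSeq; [exact: ExecRecv | exact: ex2].
  apply: ExecSeq; first exact: ExecAssign.
  by apply: ExecSeq; [exact: ExecAssign | exact: ex5].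
- by rewrite d5 s4_n.
have xB : bits x <= B by case/andP: S_bits.
have n1B : bits (n - 1) <= B by apply/leq_bits/leq_subr.
have n3E : bits (reg s3 reg_n) = B by congr bits; exact: s2_n.
rewrite /query_cost unlock /= bits1 -/r -/B.
rewrite -[reg s2 _]/(reg s3 reg_n) n3E.
by move: t2_le t5_le; rewrite /= !expnS expn0; nia.
Qed.

Theorem theorem1 (P : {poly nat}) :
  exists Q : {poly nat},
    forall (O : nat -> seq nat) (n p q : nat),
      rsa_modulus n p q ->
      (2 ^ (p - 1) != 1 %[mod q]) \/ (2 ^ (q - 1) != 1 %[mod p]) ->
      valid_answer n (O (2 ^ n + 1)) ->
      size (O (2 ^ n + 1)) <= (P.[trunc_log 2%N n])%R ->
      (forall r : nat, eligible n (O (2 ^ n + 1)) r ->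
         prime (gcdn (r - 1) n) /\ gcdn (r - 1) n %| n) /\
      (exists (r : nat) (s : state) (t : nat),
         [/\ eligible n (O (2 ^ n + 1)) r,
             exec O factor (init n) s t,
             reg s reg_d = gcdn (r - 1) n
           & t <= (Q.[trunc_log 2%N n])%R]).
Proof.
(* At [trunc_log 2 n] the factor ['X + 1] evaluates to [bits n], so this is the bound of
   [factor_exec] with [P] in place of the size of the answer. *)
exists (P * (12%N%:P * ('X + 1%N%:P)) + 59%N%:P * ('X + 1%N%:P) ^+ 3)%R.
move=> O n p q [p_pr q_pr p_lt_q nE] _ [S_fact S_sub] S_size.
(* Since [3 < n] and answers are reduced modulo [n], the program's literal tests against [1] and [3]
   agree with the tests on residue classes. *)
have n_gt3 : 3 < n by have := prime_gt1 p_pr; rewrite nE; nia.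
split=> [r [/S_fact r_fact r_n1 r_n3]|].
  by split; [move: r_fact r_n1 r_n3; rewrite nE; exact: mod_factor_gcd_prime
            | exact: dvdn_gcdr].
have S_lt x : x \in O (2 ^ n + 1) -> x < n.
  by case/S_fact => r _ ->; rewrite ltn_mod; lia.
have S_has : has (fun x => ~~ ((x == 1) || (x == 3))) (O (2 ^ n + 1)).
  rewrite has_predC; apply/negP => /allP S_13; apply: S_sub => x /S_13.
  by rewrite !inE !modn_small // ltnW // ltnW.
have S_all : all (fun x => x <= n) (O (2 ^ n + 1)).
  by apply/allP => x /S_lt /ltnW.
have [|r [s [t [r_in r_good ex d_eq t_le]]]] := factor_exec O n _ S_has S_all.
  by lia.
exists r, s, t; split=> //.
  have r_lt := S_lt _ r_in; move: r_good; rewrite negb_or => /andP[r1 r3].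
  by split; rewrite // !modn_small // ltnW // ltnW.
apply: (leq_trans t_le); rewrite hornerD (hornerM P) (hornerM 12%N%:P%R) (hornerM 59%N%:P%R) horner_exp.
rewrite hornerD hornerX !hornerC -[(_ + 1%N)%R]/(_ + 1)%N.
rewrite [trunc_log 2 n + 1]addn1 -/(bits n).
exact: leq_add (leq_mul S_size (leqnn _)) (leqnn _).
Qed.
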